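(* Let $E$ be a Banach lattice and let $T = (T(t))_{t \ge 0}$ be a positive $C_0$-semigroup on $E$ with generator $A$. Assume that $T$ is relatively uniformly continuous, i.e. for each $x \in E$ the net $(T(t)x)_{t \in (0,\infty)}$ converges relatively uniformly to $x$ as $t \downarrow 0$. Then $\operatorname{s}(A) = \omega_0(T)$, i.e. the spectral bound of $A$ equals the growth bound of $T$.
   Context: Banach lattices are real; $E_+$ denotes the positive cone of $E$. A $C_0$-semigroup is positive if each $T(t)$ maps $E_+$ into $E_+$. Relatively uniform convergence: a net $(x_j)_{j \in J}$ in $E$ converges relatively uniformly to $x \in E$ if there exists $u \in E_+$ such that for every $\varepsilon > 0$ there exists $j_0 \in J$ with $|x_j - x| \le \varepsilon u$ for all $j \succeq j_0$. ''As $t \downarrow 0$'' means that $(0,\infty)$ is directed by the converse of the usual order. The spectral bound is $\operatorname{s}(A) := \sup\{\operatorname{Re}\lambda : \lambda \in \sigma(A)\} \in [-\infty,\infty)$, where $\sigma(A)$ is the spectrum of the complex extension of $A$ to the complexification of $E$ (and $\sup\emptyset = -\infty$). The growth bound is $\omega_0(T) := \inf\{\omega \in \mathbb{R} : \exists M \ge 1 \text{ such that } \|T(t)\| \le M e^{\omega t} \text{ for all } t \ge 0\} \in [-\infty,\infty)$. *)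

(* Defs.v *)
From HB Require Import structures.
From mathcomp Require Import all_boot all_order all_algebra.
From mathcomp Require Import all_classical all_reals all_analysis.
From mathcomp Require Import complex.

Set Implicit Arguments.
Unset Strict Implicit.
Unset Printing Implicit Defensive.

Import Order.TTheory GRing.Theory Num.Theory.
Import numFieldNormedType.Exports.

Local Open Scope classical_set_scope.
Local Open Scope complex_scope.
Local Open Scope ring_scope.

(* The order and the lattice operations are fields here, and E is made a
   latticeType afterwards: HB rejects a structure that joins Order.Lattice
   with NormedModule, since numDomainType already inherits from both. *)
HB.mixin Record isBanachLattice (R : realType) E of CompleteNormedModule R E := {
  vle : rel E ;
  vmeet : E -> E -> E ;
  vjoin : E -> E -> E ;
  vle_refl : reflexive vle ;
  vle_anti : antisymmetric vle ;
  vle_trans : transitive vle ;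
  vle_meet : forall x y z, vle x (vmeet y z) = vle x y && vle x z ;
  vjoin_le : forall x y z, vle (vjoin x y) z = vle x z && vle y z ;
  vle_add2r : forall z x y : E, vle x y -> vle (x + z) (y + z) ;
  vscale_ge0 : forall (a : R) (x : E), 0 <= a -> vle 0 x -> vle 0 (a *: x) ;
  vnorm_le : forall x y : E,
    vle (vjoin x (- x)) (vjoin y (- y)) -> `|x| <= `|y|
}.

#[short(type="banachLatticeType")]
HB.structure Definition BanachLattice (R : realType) :=
  { E of isBanachLattice R E & CompleteNormedModule R E }.

#[non_forgetful_inheritance]
HB.instance Definition _ (R : realType) (E : banachLatticeType R) :=
  Order.Le_isPOrder.Build ring_display (BanachLattice.sort E)
    (@vle_refl R E) (@vle_anti R E) (@vle_trans R E).

#[non_forgetful_inheritance]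
HB.instance Definition _ (R : realType) (E : banachLatticeType R) :=
  Order.POrder_MeetJoin_isLattice.Build ring_display (BanachLattice.sort E)
    (@vle_meet R E) (@vjoin_le R E).

(* Lattice modulus; the notation `|x| is the norm. *)
Definition vabs (R : realType) (E : banachLatticeType R) (x : E) : E :=
  Order.join x (- x).

Definition ru_cvg (R : realType) (E : banachLatticeType R) (J : Type)
    (D : set J) (prec : J -> J -> Prop) (x : J -> E) (l : E) : Prop :=
  exists2 u : E, 0 <= u &
    forall eps : R, 0 < eps -> exists2 j0 : J, D j0 &
      forall j, D j -> prec j0 j -> vabs (x j - l) <= eps *: u.

(* Operators with a domain; the values outside the domain are irrelevant. *)
Record partial_op (V : Type) := PartialOp {
  dom : set V ;
  app : V -> V
}.

Section spectrum.
Context (K : numFieldType) (V : preTopologicalLmodType K).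
Implicit Type B : partial_op V.

(* l - B : D(B) -> V is a bijection with continuous linear inverse S. *)
Definition resolvent_set B : set K := [set l : K |
  exists S : {linear V -> V}, [/\ continuous S,
    forall v, dom B (S v) /\ l *: S v - app B (S v) = v &
    forall v, dom B v -> S (l *: v - app B v) = v]].

Definition spectrum B : set K := ~` resolvent_set B.
End spectrum.

(* The complexification E + iE, with (x, y) standing for x + iy. Its norm
   || |x + iy| || induces the product topology, and continuity of the resolvent
   only depends on the topology. *)
Definition cplx (R : realType) (E : completeNormedModType R) : Type :=
  (E * E)%type.

Section complexification.
Context (R : realType) (E : completeNormedModType R).

HB.instance Definition _ := Topological.copy (cplx E) (E * E)%type.
HB.instance Definition _ := GRing.Zmodule.copy (cplx E) (E * E)%type.

Definition cplx_scale (l : R[i]) (z : cplx E) : cplx E :=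
  (complex.Re l *: z.1 - complex.Im l *: z.2,
   complex.Im l *: z.1 + complex.Re l *: z.2).

Lemma cplx_scaleA l m z :
  cplx_scale l (cplx_scale m z) = cplx_scale (l * m) z.
Proof.
case: l m z => [a b] [c d] [x y]; rewrite /cplx_scale /=; congr pair.
  rewrite !scalerDr !scalerN !scalerA !scalerBl !scalerDl !opprD.
  by rewrite addrACA.
rewrite !scalerDr !scalerN !scalerA !scalerBl !scalerDl.
by rewrite addrACA addrC [RHS]addrC; congr (_ + _); rewrite addrC.
Qed.

Lemma cplx_scale1 : left_id 1 cplx_scale.
Proof.
by case=> x y; rewrite /cplx_scale /= !scale1r !scale0r subr0 add0r.
Qed.

Lemma cplx_scaleDr : right_distributive cplx_scale +%R.
Proof.
move=> [a b] [x y] [x' y']; rewrite /cplx_scale /=; congr pair => /=.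
  by rewrite !scalerDr opprD addrACA.
by rewrite !scalerDr addrACA.
Qed.

Lemma cplx_scaleDl z : {morph cplx_scale^~ z : l m / l + m}.
Proof.
move=> [a b] [c d]; case: z => [x y]; rewrite /cplx_scale /=.
congr pair => /=.
  by rewrite !scalerDl opprD addrACA.
by rewrite !scalerDl addrACA.
Qed.

HB.instance Definition _ := GRing.Zmodule_isLmodule.Build R[i] (cplx E)
  cplx_scaleA cplx_scale1 cplx_scaleDr cplx_scaleDl.

Definition cplx_op (A : partial_op E) : partial_op (cplx E) :=
  PartialOp (V := cplx E)
    [set z | dom A z.1 /\ dom A z.2] (fun z => (app A z.1, app A z.2)).
End complexification.

Definition spectral_bound (R : realType) (E : completeNormedModType R)
    (A : partial_op E) : \bar R :=
  ereal_sup [set (complex.Re l)%:E | l in spectrum (cplx_op A)].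

Definition opnorm (R : realType) (E : normedModType R) (S : E -> E) : \bar R :=
  ereal_sup [set `|S x|%:E | x in [set x : E | `|x| <= 1]].

(* A semigroup is given by a family T t indexed by the reals, of which only the
   members with 0 <= t matter. *)
Section semigroup.
Context (R : realType) (E : completeNormedModType R).
Implicit Type T : R -> {linear E -> E}.

Definition C0_semigroup T : Prop :=
  [/\ forall t, 0 <= t -> continuous (T t),
      forall x, T 0 x = x,
      forall s t, 0 <= s -> 0 <= t -> forall x, T (s + t) x = T s (T t x) &
      forall x, T t x @[t --> 0^'+] --> x].

Definition diff_quot T (x : E) (h : R) : E := h^-1 *: (T h x - x).

Definition generator T : partial_op E := PartialOp
  [set x | cvg (diff_quot T x h @[h --> 0^'+])]
  (fun x => lim (diff_quot T x h @[h --> 0^'+])).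

Definition growth_bound T : \bar R :=
  ereal_inf [set w%:E | w in [set w : R | exists2 M : R, 1 <= M &
    forall t, 0 <= t -> (opnorm (T t) <= (M * expR (w * t))%:E)%E]].
End semigroup.

Definition positive_semigroup (R : realType) (E : banachLatticeType R)
    (T : R -> {linear E -> E}) : Prop :=
  forall t, 0 <= t -> forall x, 0 <= x -> 0 <= T t x.

(* The net (T t x) for t > 0 is directed by the converse order. *)
Definition ru_continuous (R : realType) (E : banachLatticeType R)
    (T : R -> {linear E -> E}) : Prop :=
  forall x, ru_cvg [set t : R | 0 < t] (fun s t => t <= s) (fun t => T t x) x.

(* Main.v *)
Require Import Defs.
From HB Require Import structures.
From mathcomp Require Import all_boot all_order all_algebra.
From mathcomp Require Import all_classical all_reals all_analysis.
From mathcomp Require Import complex ring lra.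

(* For the inequality [spectral bound <= growth bound], the resolvent of A at
   [a] is the inverse of the generator of [S t := expR (- (a * t)) *: T t], up
   to sign. If [S tau] is a contraction by 1/2, then [x = S tau x - v] has a
   solution [x], and the primitive of [r |-> S r x] over [[0, tau]] is mapped
   to [v] by the generator of [S]. A complex [a + ib] reduces to the real
   [a] for the rotated semigroup [exp (- i b t) T t] on E * E. Integrals of
   orbits are replaced by limits of Riemann sums throughout.

   For the converse, let [l] exceed the spectral bound and let
   [S t := expR (- (l * t)) *: T t]. The resolvent G at [l] is positive: it is
   so far to the right, and positivity propagates to the left along
   [[l, +oo[] by the Neumann series. For [x >= 0], relatively uniform
   continuity gives [w] and [d > 0] with [S r x <= w] on [[0, d]]. Then
   [S t x = S (t - r) (S r x) <= S (t - r) w] for all [r] in [[0, d]], and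
   averaging over [r] yields [d *: S t x <= G w] for all [t >= d]: the orbits
   of S are bounded, hence so is S, by the Banach-Steinhaus theorem. *)

Set Implicit Arguments.
Unset Strict Implicit.
Unset Printing Implicit Defensive.

Import Order.TTheory GRing.Theory Num.Theory.
Import numFieldNormedType.Exports.

Local Open Scope classical_set_scope.
Local Open Scope ring_scope.

(** * One-sided limits and uniform boundedness of linear maps *)

Lemma cvg_right0P (R : realType) (V : normedModType R) (f : R -> V) (l : V) :
  f h @[h --> 0^'+] --> l <->
  forall e, 0 < e -> exists2 d, 0 < d & forall h, 0 < h -> h <= d -> `|f h - l| <= e.
Proof.
split=> [/cvgrPdistC_le|] fl; last apply/cvgrPdistC_le => e e0; first move=> e e0.
  have [d /= d0 fd] := fl e e0; exists (d / 2); first by rewrite divr_gt0.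
  move=> h h0 hd; apply: fd => //=; rewrite sub0r normrN gtr0_norm//.
  by rewrite (le_lt_trans hd)// ltr_pdivrMr// ltr_pMr// ltr1n.
have [d d0 fd] := fl e e0.
near=> h; apply: fd.
  by near: h; exact: nbhs_right_gt.
by near: h; exact: nbhs_right_le.
Unshelve. all: by end_near. Qed.

Section linear_bounds.
Context (R : realType).

Lemma continuous_linearP (V W : normedModType R) (f : {linear V -> W}) :
  continuous f <-> exists2 C, 0 < C & forall x, `|f x| <= C * `|x|.
Proof.
rewrite -linear_bounded_continuous linear_boundedP; split.
  by move=> /pinfty_ex_gt0 [C C0 fC]; exists C.
move=> [C C0 fC]; near=> r => x; apply: (le_trans (fC x)).
by rewrite ler_wpM2r//; near: r; apply: nbhs_pinfty_ge; rewrite gtr0_real.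
Unshelve. all: by end_near. Qed.

Lemma unit_ball_bound (V W : normedModType R) (f : {linear V -> W}) (c : R) :
  (forall x, `|x| <= 1 -> `|f x| <= c) -> forall x, `|f x| <= c * `|x|.
Proof.
move=> fc x; have [->|x0] := eqVneq x 0; first by rewrite linear0 !normr0 mulr0.
have nx0 : 0 < `|x| by rewrite normr_gt0.
have := fc (`|x|^-1 *: x); rewrite linearZ !normrZ normfV normr_id.
by rewrite mulVf ?gt_eqF// lexx => /(_ isT); rewrite ler_pdivrMl// mulrC.
Qed.

Lemma opnorm_le (V : normedModType R) (f : {linear V -> V}) (c : R) : 0 <= c ->
  (opnorm f <= c%:E)%E <-> forall x, `|f x| <= c * `|x|.
Proof.
move=> c0; split=> [fc|fc].
  apply: (unit_ball_bound (f := f)) => y y1.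
  by rewrite -lee_fin; apply: le_trans fc; apply: ereal_sup_ubound; exists y.
apply: ge_ereal_sup => _ [x /= x1 <-].
by rewrite lee_fin (le_trans (fc x))// ler_piMr.
Qed.
End linear_bounds.

Section uniform_boundedness.
Context (R : realType) (V : completeNormedModType R) (W : normedModType R).

Lemma uniform_boundedness (I : Type) (D : set I) (f : I -> {linear V -> W}) :
  (forall i, D i -> continuous (f i)) ->
  (forall x, exists M, forall i, D i -> `|f i x| <= M) ->
  exists2 M, 0 < M & forall i, D i -> forall x, `|f i x| <= M * `|x|.
Proof.
move=> fcont fbnd.
have [||M BM] := @Banach_Steinhauss R V W [set (f i : V -> W) | i in D] _ _ 1.
- move=> _ [i Di <-]; split; last exact: linearP.
  apply/bounded_funP; exact/linear_bounded_continuous/fcont.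
- by move=> x; have [M BM] := fbnd x; exists M => _ [i Di <-]; exact: BM.
exists (Num.max M 1) => [|i Di]; first by rewrite lt_max ltr01 orbT.
apply: unit_ball_bound => x x1; rewrite (@le_trans _ _ M)//.
  by apply: BM => //; exists i.
by rewrite le_max lexx.
Qed.
End uniform_boundedness.

(** * Bounds on C0-semigroups *)

Section semigroup_bounds.
Context (R : realType) (E : completeNormedModType R) (T : R -> {linear E -> E}).
Hypothesis C0T : C0_semigroup T.

Lemma C0_near0 (x : E) (e : R) : 0 < e ->
  exists2 d, 0 < d & forall r, 0 <= r -> r <= d -> `|T r x - x| <= e.
Proof.
case: C0T => _ T0 _ Tx e0; have [d d0 xd] := (cvg_right0P _ _).1 (Tx x) e e0.
exists d => // r; rewrite le_eqVlt => /predU1P[<- _|]; last exact: xd.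
by rewrite T0 subrr normr0 ltW.
Qed.

(** Otherwise there are times [t n <= n.+1%:R^-1] at which [T (t n)] violates the bound [n.+1];
    strong continuity at 0 makes these operators pointwise bounded, contradicting uniform
    boundedness. *)
Lemma C0_bound0 : exists2 d, 0 < d & exists2 M, 1 <= M &
  forall r, 0 <= r -> r <= d -> forall x, `|T r x| <= M * `|x|.
Proof.
case: (C0T) => Tc _ _ _; apply: contrapT => nbd.
have /choice[t tP] n : exists t, [/\ 0 <= t, t <= n.+1%:R^-1 &
    ~ forall x, `|T t x| <= n.+1%:R * `|x|].
  apply: contrapT => nt; apply: nbd; exists n.+1%:R^-1; first by rewrite invr_gt0.
  exists n.+1%:R => [|r r0 rn]; first by rewrite ler1n.
  by apply: contrapT => nr; apply: nt; exists r.
have [n _|x|M M0 BM] := @uniform_boundedness R E E nat setT (fun n => T (t n)).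
- by apply: Tc; case: (tP n).
- have [d d0 dx] := C0_near0 x ltr01.
  (* For [n] beyond [d^-1] the vector [T (t n) x] is within 1 of [x]; the sum covers the finitely
     many other [n]. *)
  exists (`|x| + 1 + \sum_(k < (Num.truncn d^-1).+1) `|T (t k) x|) => n _.
  case: (ltnP n (Num.truncn d^-1).+1) => nd.
    by rewrite (bigD1 (Ordinal nd))//= addrCA lerDl !addr_ge0// sumr_ge0.
  rewrite ler_wpDr ?sumr_ge0// -lerBlDl (le_trans (lerB_dist _ _))//.
  case: (tP n) => t0 tn _; apply: dx => //; rewrite (le_trans tn)//.
  rewrite invf_ple ?posrE// ltW// (lt_le_trans (truncnS_gt _))//.
  by rewrite ler_nat ltnW.
- case: (tP (Num.truncn M)) => _ _; apply => x; rewrite (le_trans (BM _ I x))//.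
  by rewrite ler_wpM2r// ltW// truncnS_gt.
Qed.

(** Write [t] as [n * d] plus a remainder in [[0, d]]: the norm of [T t] is at most [M * M ^+ n],
    and [M ^+ n] is the exponential of [n * ln M]. *)
Lemma C0_growth : exists M w, [/\ 1 <= M, 0 <= w &
  forall t, 0 <= t -> forall x, `|T t x| <= M * expR (w * t) * `|x|].
Proof.
case: (C0T) => _ T0 TD _; have [d d0 [M M1 BM]] := C0_bound0.
have Mpos : 0 < M by rewrite (lt_le_trans ltr01).
exists M, (ln M / d); split => //; first by rewrite divr_ge0 ?ln_ge0// ltW.
have Bn (n : nat) x : `|T (n%:R * d) x| <= M ^+ n * `|x|.
  elim: n x => [|n IH] x; first by rewrite mul0r T0 mul1r.
  rewrite mulrS mulrDl mul1r TD ?mulr_ge0 ?(ltW d0)//.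
  by rewrite (le_trans (BM _ (ltW d0) (lexx _) _))// exprS -mulrA ler_wpM2l// ltW.
move=> t t0 x; set n := Num.truncn (t / d).
have /andP[nt tn] : n%:R <= t / d < n.+1%:R by rewrite truncn_itv// divr_ge0// ltW.
rewrite -{1}(subrK (n%:R * d) t) TD ?mulr_ge0 ?(ltW d0)//; last first.
  by rewrite subr_ge0 -ler_pdivlMr.
rewrite (le_trans (BM _ _ _ _))//.
- by rewrite subr_ge0 -ler_pdivlMr.
- by rewrite lerBlDr -[X in X + _]mul1r -mulrDl -mulrS -ler_pdivrMr// ltW.
rewrite -mulrA ler_pM2l// (le_trans (Bn _ _))// ler_wpM2r//.
rewrite -[X in X ^+ _](lnK Mpos) -expRM_natl ler_expR mulrC -mulrA.
by rewrite ler_wpM2l ?ln_ge0// mulrC.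
Qed.

Lemma C0_bound_on (t : R) : exists2 M, 1 <= M &
  forall r, 0 <= r -> r <= t -> forall x, `|T r x| <= M * `|x|.
Proof.
have [M [w [M1 w0 BM]]] := C0_growth.
exists (M * expR (w * Num.max t 0)).
  rewrite (le_trans M1)// ler_peMr ?(le_trans ler01)//.
  by rewrite -expR0 ler_expR mulr_ge0// le_max lexx orbT.
move=> r r0 rt x; rewrite (le_trans (BM _ r0 x))// ler_wpM2r//.
rewrite ler_pM2l ?(lt_le_trans ltr01)//.
by rewrite ler_expR ler_wpM2l// le_max rt.
Qed.

End semigroup_bounds.

(** * Riemann sums of orbits *)

Section riemann_sums.
Context (R : realType) (E : completeNormedModType R) (T : R -> {linear E -> E}).
Hypothesis C0T : C0_semigroup T.

(** Multiplied by [h], this is the left Riemann sum of the orbit of [x] over [[0, n * h]]. *)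
Definition rsum (h : R) n (x : E) : E := \sum_(k < n) T (k%:R * h) x.

Lemma rsumD h m n x : 0 <= h ->
  rsum h (m + n) x = rsum h m x + T (m%:R * h) (rsum h n x).
Proof.
move=> h0; rewrite /rsum big_split_ord/= linear_sum; congr (_ + _).
apply: eq_bigr => k _; rewrite natrD mulrDl.
by case: C0T => _ _ -> //; rewrite mulr_ge0.
Qed.

(** The sum of [m + n] terms can be split after [m] or after [n] of them. *)
Lemma rsum_shift h m n x : 0 <= h ->
  T (m%:R * h) (rsum h n x) - rsum h n x = T (n%:R * h) (rsum h m x) - rsum h m x.
Proof.
move=> h0; apply/eqP; rewrite subr_eq addrAC eq_sym subr_eq; apply/eqP.
by rewrite addrC -rsumD// addnC rsumD// addrC.
Qed.

Lemma rsumB h n x y : rsum h n (x - y) = rsum h n x - rsum h n y.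
Proof. by rewrite /rsum -sumrB; apply: eq_bigr => k _; rewrite linearB. Qed.

Lemma rsumZ h n a x : rsum h n (a *: x) = a *: rsum h n x.
Proof. by rewrite /rsum scaler_sumr; apply: eq_bigr => k _; rewrite linearZ. Qed.

Lemma rsum1 h x : rsum h 1 x = x.
Proof. by rewrite /rsum big_ord1 mul0r; case: C0T => _ ->. Qed.

Lemma rsumM h n p x : 0 <= h -> rsum h (n * p) x = rsum (p%:R * h) n (rsum h p x).
Proof.
move=> h0; elim: n => [|n IH]; first by rewrite /rsum !big_ord0.
rewrite mulSnr -addn1 rsumD// rsumD ?mulr_ge0// rsum1 -IH.
by rewrite natrM mulrA.
Qed.

Lemma rsum_le (M t h : R) n x : 0 <= h -> n%:R * h <= t ->
  (forall r, 0 <= r -> r <= t -> forall x, `|T r x| <= M * `|x|) ->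
  `|rsum h n x| <= n%:R * (M * `|x|).
Proof.
move=> h0 nt BM; rewrite (le_trans (ler_norm_sum _ _ _))//.
rewrite mulr_natl -[in leRHS](card_ord n) -sumr_const ler_sum// => k _.
rewrite BM ?mulr_ge0// (le_trans _ nt)// ler_wpM2r// ler_nat.
by rewrite ltnW.
Qed.

Lemma rsum_near (d e h : R) n x : 0 <= h -> n%:R * h <= d ->
  (forall r, 0 <= r -> r <= d -> `|T r x - x| <= e) ->
  `|rsum h n x - n%:R *: x| <= n%:R * e.
Proof.
move=> h0 nt Te; have -> : n%:R *: x = \sum_(k < n) x.
  by rewrite sumr_const card_ord scaler_nat.
rewrite -sumrB (le_trans (ler_norm_sum _ _ _))//.
rewrite mulr_natl -[in leRHS](card_ord n) -sumr_const ler_sum// => k _.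
rewrite Te ?mulr_ge0// (le_trans _ nt)// ler_wpM2r// ler_nat.
by rewrite ltnW.
Qed.
End riemann_sums.

(** * The graph of the generator and integration along orbits *)

Section generator_lemmas.
Context (R : realType) (E : completeNormedModType R) (T : R -> {linear E -> E}).
Hypothesis C0T : C0_semigroup T.

(** The graph of the generator: one relation replaces membership in the domain together with the
    value of a limit. *)
Definition gen_at (S : R -> {linear E -> E}) (x y : E) : Prop :=
  diff_quot S x h @[h --> 0^'+] --> y.

Lemma gen_atP S x y : gen_at S x y <-> forall e, 0 < e -> exists2 d, 0 < d &
  forall h, 0 < h -> h <= d -> `|S h x - x - h *: y| <= h * e.
Proof.
have E1 h : 0 < h -> S h x - x - h *: y = h *: (diff_quot S x h - y).
  by move=> h0; rewrite scalerBr scalerA mulfV ?gt_eqF// scale1r.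
rewrite /gen_at cvg_right0P; split=> H e e0; have [d d0 dP] := H e e0;
  exists d => // h h0 hd.
  by rewrite E1// normrZ gtr0_norm// ler_wpM2l ?(ltW h0)// dP.
by have := dP h h0 hd; rewrite E1// normrZ gtr0_norm// ler_pM2l.
Qed.

Lemma generatorP S x : dom (generator S) x <-> exists y, gen_at S x y.
Proof. by rewrite /gen_at -cvg_ex. Qed.

Lemma generatorE S x y : gen_at S x y ->
  dom (generator S) x /\ app (generator S) x = y.
Proof. by move=> xy; split; [apply/generatorP; exists y | exact/cvg_lim]. Qed.

Lemma generator_gen_at S x : dom (generator S) x -> gen_at S x (app (generator S) x).
Proof. by move=> /generatorP [y xy]; have [_ ->] := generatorE xy. Qed.

Lemma rsum_comm s h n x : 0 <= s -> 0 <= h ->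
  T s (rsum T h n x) = rsum T h n (T s x).
Proof.
move=> s0 h0; rewrite /rsum linear_sum; apply: eq_bigr => k _ /=.
by case: C0T => _ _ TD _; rewrite -!TD ?mulr_ge0// addrC.
Qed.

(** Telescoping turns [T t v - v] into [rsum T h n (T h v - v)], where [T h v - v] is [h *: y] up to
    o(h). In the limit this is the integral of [T r y] over [[0, t]]. *)
Lemma riemann_gen v y t : gen_at T v y -> 0 <= t -> forall e, 0 < e ->
  exists2 N, (0 < N)%N & forall n, (N <= n)%N ->
  `|T t v - v - (t / n%:R) *: rsum T (t / n%:R) n y| <= e.
Proof.
move=> /gen_atP vy t0 e e0; have [M M1 BM] := C0_bound_on C0T t.
have tM : 0 < t * M + 1 by rewrite ltr_wpDl// mulr_ge0// (le_trans ler01).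
have [d d0 dP] := vy _ (divr_gt0 e0 tM).
exists (Num.truncn (t / d)).+1 => // n Nn.
have n0 : 0 < n%:R :> R by rewrite ltr0n (leq_trans _ Nn).
move: t0; rewrite le_eqVlt => /predU1P[<-|t0].
  by case: C0T => _ -> _ _; rewrite mul0r scale0r !subr0 subrr normr0 ltW.
set h := t / n%:R; have h0 : 0 < h by rewrite divr_gt0.
have nh : n%:R * h = t by rewrite mulrC divfK ?gt_eqF.
have hd : h <= d.
  rewrite ler_pdivrMr// mulrC -ler_pdivrMr// ltW//.
  by rewrite (lt_le_trans (truncnS_gt _))// ler_nat.
have -> : T t v - v = rsum T h n (T h v - v).
  have := rsum_shift C0T n 1 v (ltW h0); rewrite !rsum1// nh mul1r => ->.
  by rewrite rsumB rsum_comm ?(ltW h0).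
rewrite -rsumZ -rsumB (le_trans (rsum_le (t := t) _ _ _ BM)) ?nh ?(ltW h0)//.
rewrite (@le_trans _ _ (n%:R * (M * (h * (e / (t * M + 1))))))//.
  by rewrite ler_wpM2l ?ler0n// ler_wpM2l ?dP// (le_trans ler01).
have -> : n%:R * (M * (h * (e / (t * M + 1)))) = e * (t * M / (t * M + 1)).
  by rewrite -nh; ring.
by rewrite ler_piMr ?(ltW e0)// ler_pdivrMr// mul1r lerDl.
Qed.

(** By [rsumM] the difference is a sum over [n] blocks, and in each block [p] orbit values are
    compared with the first of them. *)
Lemma rsum_refine M t e h n p x : 0 <= h -> (n * p)%:R * h <= t ->
  (forall r, 0 <= r -> r <= t -> forall x, `|T r x| <= M * `|x|) -> 0 <= M ->
  (forall r, 0 <= r -> r <= p%:R * h -> `|T r x - x| <= e) ->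
  `|h *: rsum T h (n * p) x - (p%:R * h) *: rsum T (p%:R * h) n x|
    <= (n * p)%:R * h * M * e.
Proof.
move=> h0 nt BM M0 Te; rewrite rsumM// -!rsumZ -rsumB.
rewrite (le_trans (rsum_le (t := t) _ _ _ BM)) ?mulr_ge0//.
  by rewrite mulrA -natrM.
rewrite rsumZ (mulrC p%:R h) -scalerA -scalerBr normrZ ger0_norm//.
have := rsum_near (d := p%:R * h) (e := e) h0 (lexx _) Te => H.
rewrite natrM (_ : _ * M * e = n%:R * (M * (h * (p%:R * e)))); last by ring.
by rewrite !ler_wpM2l.
Qed.

End generator_lemmas.

(** * Inverting the generator when some [T tau] halves norms *)

Section resolvent.
Context (R : realType) (E : completeNormedModType R) (T : R -> {linear E -> E}).
Hypothesis C0T : C0_semigroup T.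

Lemma dyadic_small (t d : R) : 0 < d -> \forall n \near \oo, t / (2 ^ n)%:R <= d.
Proof.
move=> d0; exists (Num.truncn (t / d)).+1 => // n /= Nn.
rewrite ler_pdivrMr ?ltr0n ?expn_gt0// mulrC -ler_pdivrMr//.
rewrite ltW// (lt_le_trans (truncnS_gt _))// ler_nat (leq_trans Nn)//.
by rewrite ltnW// ltn_expl.
Qed.

(** Dyadic meshes refine one another, so that [rsum_refine] compares any two of these sums. *)
Definition dyadic_sum (t : R) (y : E) (n : nat) : E :=
  (t / (2 ^ n)%:R) *: rsum T (t / (2 ^ n)%:R) (2 ^ n) y.

Lemma dyadic_sum_cvg t y : 0 < t -> cvgn (dyadic_sum t y).
Proof.
move=> t0; have [M M1 BM] := C0_bound_on C0T t.
have M0 : 0 <= M by rewrite (le_trans ler01).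
have h0 n : 0 < t / (2 ^ n)%:R by rewrite divr_gt0// ltr0n expn_gt0.
apply/cauchy_cvgP; apply: cauchy_exP => e e0.
have tM : 0 < t * M + 1 by rewrite ltr_wpDl// mulr_ge0// ltW.
have [d d0 dP] := C0_near0 C0T y (divr_gt0 e0 tM).
have [N _ NP] := dyadic_small t d0.
exists (dyadic_sum t y N); exists N => // m /= Nm; rewrite -ball_normE /= distrC.
have mE : (2 ^ m = 2 ^ N * 2 ^ (m - N))%N by rewrite -expnD subnKC.
have pE : (2 ^ (m - N))%:R * (t / (2 ^ m)%:R) = t / (2 ^ N)%:R.
  by rewrite mE natrM; field; rewrite !pnatr_eq0 !expn_eq0.
have tE : (2 ^ m)%:R * (t / (2 ^ m)%:R) = t.
  by rewrite mulrC divfK// pnatr_eq0 expn_eq0.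
have := @rsum_refine R E T C0T M t (e / (t * M + 1)) (t / (2 ^ m)%:R)
  (2 ^ N) (2 ^ (m - N)) y.
rewrite -mE pE tE => /(_ (ltW (h0 _)) (lexx _) BM M0) H.
rewrite (le_lt_trans (H _))//.
  by move=> r r0 rN; rewrite dP// (le_trans rN)// NP/=.
by rewrite mulrCA gtr_pMr// ltr_pdivrMr// mul1r ltrDl.
Qed.

(* The limit [z] of the Riemann sums plays the role of the integral of
   [T r y] over [r] in [[0, tau]]. *)
Lemma primitive_gen tau y : 0 < tau -> exists z, gen_at T z (T tau y - y).
Proof.
move=> tau0; set w := T tau y - y.
have Tz : dyadic_sum tau y n @[n --> \oo] --> limn (dyadic_sum tau y).
  exact: dyadic_sum_cvg.
set z := limn _ in Tz; exists z; apply/gen_atP => e e0.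
have [M M1 BM] := C0_bound_on C0T (tau + 1).
have M0 : 0 < M by rewrite (lt_le_trans ltr01).
have M10 : 0 < M + 1 by rewrite addr_gt0.
have [d d0 dP] := C0_near0 C0T y (divr_gt0 e0 M10).
exists (Num.min d 1); first by rewrite lt_min d0 ltr01.
move=> t t0; rewrite le_min => /andP[td t1].
(* The slack [eta] absorbs the errors of the Riemann sums, since the mesh is chosen only after
   [eta]. *)
apply/ler_addgt0Pr => eta eta0.
(* [C] counts the errors [eta'] collected in [s1], [s2], [s4] and [s5]. *)
pose C := M + M + 1 + `|w|.
have C0 : 0 < C by rewrite ltr_wpDr// addr_gt0// addr_gt0.
pose eta' := eta / C; have eta'0 : 0 < eta' by rewrite divr_gt0.
have [d' d'0 dP'] := C0_near0 C0T z eta'0.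
near \oo => n.
have zn : `|z - dyadic_sum tau y n| <= eta'.
  by near: n; move/cvgrPdist_le: Tz; apply.
have hd' : tau / (2 ^ n)%:R <= d' by near: n; exact: dyadic_small.
have heta : tau / (2 ^ n)%:R <= eta' by near: n; exact: dyadic_small.
move: zn hd' heta; rewrite /dyadic_sum; set h := tau / _; set N := (2 ^ n)%N.
set J := _ *: _ => zn hd' heta.
have h0 : 0 < h by rewrite divr_gt0// ltr0n expn_gt0.
have Nh : N%:R * h = tau by rewrite mulrC divfK// pnatr_eq0 expn_eq0.
(* The time [t] is rounded down to a multiple [s] of the mesh, so that [rsum_shift] applies to
   [T s J]. *)
pose k := Num.truncn (t / h).
have /andP[kt tk] : k%:R <= t / h < k.+1%:R by rewrite truncn_itv// divr_ge0// ltW.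
pose s := k%:R * h; have s0 : 0 <= s by rewrite mulr_ge0// ltW.
have st : s <= t by rewrite -ler_pdivlMr.
have ts : t - s <= h.
  by rewrite lerBlDr -[X in X + _]mul1r -mulrDl -mulrS -ler_pdivrMr// ltW.
have ts0 : 0 <= t - s by rewrite subr_ge0.
have sb : s <= tau + 1 by rewrite (le_trans st)// (le_trans t1)// lerDr ltW.
pose q := h *: rsum T h k y - s *: y.
have qe : `|q| <= s * (e / (M + 1)).
  rewrite /q (_ : s = h * k%:R); last exact: mulrC.
  rewrite -scalerA -scalerBr normrZ gtr0_norm// -mulrA ler_pM2l//.
  apply: (rsum_near (d := d)); [exact: ltW|exact: le_trans td|].
  by move=> r r0 rd; exact: dP.
have s1 : `|T t z - T s z| <= M * eta'.
  have -> : T t z = T s (T (t - s) z).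
    by case: C0T => _ _ <- //; rewrite addrC subrK.
  rewrite -linearB (le_trans (BM _ s0 sb _))// ler_pM2l//.
  by rewrite dP'// (le_trans ts).
have s2 : `|T s z - T s J| <= M * eta'.
  by rewrite -linearB (le_trans (BM _ s0 sb _))// ler_pM2l.
have s3 : `|T s J - (J + s *: w)| <= t * e.
  (* By [rsum_shift], [T s J - J] is [T tau] minus the identity, applied to the Riemann sum over
     [[0, s]]; that sum is [s *: y + q]. *)
  have -> : T s J - (J + s *: w) = T tau q - q.
    rewrite opprD addrA {1 2}/J linearZ -scalerBr rsum_shift ?(ltW h0)// Nh.
    rewrite scalerBr -linearZ /w scalerBr -linearZ /q.
    by rewrite !opprD !opprK addrACA linearB.
  rewrite (le_trans (ler_normB _ _))//.
  have /le_trans -> // : `|T tau q| + `|q| <= (M + 1) * `|q|.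
    by rewrite mulrDl mul1r lerD2r BM// ?lerDl// ltW.
  rewrite (@le_trans _ _ ((M + 1) * (s * (e / (M + 1)))))// ?ler_pM2l//.
  by rewrite mulrCA mulrC (mulrC _ (e / _)) divfK ?gt_eqF// mulrC ler_pM2r.
have s4 : `|(J + s *: w) - (z + s *: w)| <= eta'.
  by rewrite opprD addrACA subrr addr0 distrC.
have s5 : `|(z + s *: w) - (z + t *: w)| <= eta' * `|w|.
  rewrite opprD addrACA subrr add0r -scalerBl normrZ distrC ler_wpM2r//.
  by rewrite ger0_norm// (le_trans ts).
rewrite -addrA -opprD.
(* The chain leads from [T t z] via [T s z], [T s J], [J + s *: w] and [z + s *: w] to
   [z + t *: w]. *)
rewrite (le_trans (ler_distD (T s z) _ _))//.
have -> : eta = M * eta' + (M * eta' + (eta' + eta' * `|w|)).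
  by rewrite /eta' /C; field; rewrite gt_eqF.
rewrite addrCA lerD//.
rewrite (le_trans (ler_distD (T s J) _ _))// addrCA lerD//.
rewrite (le_trans (ler_distD (J + s *: w) _ _))// lerD//.
by rewrite (le_trans (ler_distD (z + s *: w) _ _))// lerD.
Unshelve. all: by end_near. Qed.

(** Since [T tau] halves norms, the norm of [z] is at most twice that of [T tau z - z], which is the
    integral of the orbit of [v] over [[0, tau]]. *)
Lemma gen_norm_le tau : 0 < tau -> (forall x, `|T tau x| <= 2^-1 * `|x|) ->
  exists2 C, 0 < C & forall z v, gen_at T z v -> `|z| <= C * `|v|.
Proof.
move=> tau0 half; have [M M1 BM] := C0_bound_on C0T tau.
have M0 : 0 < M by rewrite (lt_le_trans ltr01).
exists (2 * (tau * M)) => [|z v zv]; first by rewrite !mulr_gt0.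
have H : `|T tau z - z| <= tau * M * `|v|.
  apply/ler_addgt0Pr => e e0.
  have [N N0 /(_ N (leqnn _))] := riemann_gen C0T zv (ltW tau0) e0.
  set h := tau / _; have h0 : 0 < h by rewrite divr_gt0// ltr0n.
  have Nh : N%:R * h = tau by rewrite mulrC divfK// pnatr_eq0 -lt0n.
  clearbody h.
  move=> /(le_trans (lerB_dist _ _)); rewrite lerBlDr => /le_trans; apply.
  rewrite addrC lerD2r normrZ gtr0_norm// -[in leRHS]Nh -!mulrA mulrCA.
  by rewrite ler_pM2l// (rsum_le (t := tau)) ?Nh// ltW.
have : `|z| - `|T tau z| <= tau * M * `|v|.
  by rewrite (le_trans _ H)// distrC lerB_dist.
have := half z; lra.
Qed.

Lemma gen_surj tau : 0 < tau -> (forall x, `|T tau x| <= 2^-1 * `|x|) ->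
  forall v, exists z, gen_at T z v.
Proof.
move=> tau0 half v.
pose f : {fun [set: E] >-> [set: E]} := totalfun_ [set: E] (fun x : E => T tau x - v).
have [||x _ xE] := @banach_fixed_point R E setT f _ closedT.
- exists (2^-1)%:nng; split; first by rewrite invf_lt1// ltr1n.
  move=> [x y] _ /=; rewrite /totalfun_ opprD addrACA opprK addNr addr0.
  by rewrite -linearB half.
- by exists 0.
have [z zP] := primitive_gen x tau0; exists z.
suff <- : T tau x - x = v by [].
by rewrite {2}xE /= /totalfun_ opprB addrC subrK.
Qed.

End resolvent.

(** * Resolvents of rescaled and rotated semigroups *)

Section rescaling.
Context (R : realType) (E : completeNormedModType R).
Implicit Types (T : R -> {linear E -> E}) (x y : E) (a : R).

Lemma gen_at_linear T a x x' y y' :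
  gen_at T x y -> gen_at T x' y' -> gen_at T (a *: x + x') (a *: y + y').
Proof.
move=> xy xy'; rewrite /gen_at.
have -> : diff_quot T (a *: x + x') = (fun h => a *: diff_quot T x h + diff_quot T x' h).
  apply/funext => h; rewrite /diff_quot linearP scalerA (mulrC a) -scalerA -scalerDr.
  by congr (_ *: _); rewrite scalerBr opprD addrACA.
by apply: cvgD xy'; apply: cvgZl_tmp.
Qed.

Lemma cvg_right_diff (f : R -> R) (d : R) : is_derive (0 : R) 1 f d ->
  h^-1 * (f h - f 0) @[h --> 0^'+] --> d.
Proof.
move=> [fd fE].
suff H : h^-1 * (f h - f 0) @[h --> 0^'] --> d.
  by apply: (@cvg_dnbhs_at_right R R (fun h => h^-1 * (f h - f 0))).
rewrite -fE /derive; apply: cvg_trans fd.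
apply: near_eq_cvg; near=> h.
by rewrite /= addr0 [h *: 1]mulr1.
Unshelve. all: by end_near. Qed.

Lemma cvg_right_cont (f : R -> R) : continuous f -> f h @[h --> 0^'+] --> f 0.
Proof. by move=> fc; apply: cvg_at_right_filter; exact: fc. Qed.

Lemma cvg_right_expR a : expR (- (a * h)) @[h --> 0^'+] --> (1 : R).
Proof.
have := @cvg_right_cont (fun h => expR (- (a * h))).
rewrite mulr0 oppr0 expR0; apply => z.
by apply: differentiable_continuous; exact/derivable1_diffP.
Qed.

Definition rescale a T (t : R) : {linear E -> E} := expR (- (a * t)) \*: T t.

Lemma rescaleK a T x h : rescale (- a) (rescale a T) h x = T h x.
Proof. by rewrite /rescale /= scalerA -expRD mulNr opprK subrr expR0 scale1r. Qed.

(** Product rule for the factors [expR (- (a * h))] and [T h x]: the generator becomes A - a. *)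
Lemma gen_at_rescale a T x y :
  gen_at T x y -> gen_at (rescale a T) x (y - a *: x).
Proof.
move=> xy; rewrite /gen_at.
have -> : diff_quot (rescale a T) x = (fun h => expR (- (a * h)) *: diff_quot T x h +
    (h^-1 * (expR (- (a * h)) - expR (- (a * 0)))) *: x).
  apply/funext => h; rewrite /diff_quot /rescale /= mulr0 oppr0 expR0.
  rewrite scalerA (mulrC (expR _)) -!scalerA -scalerDr; congr (_ *: _).
  by rewrite scalerBr scalerBl scale1r addrA subrK.
rewrite -(scaleNr a x); apply: cvgD; last first.
  apply: cvgZr_tmp; apply: (@cvg_right_diff (fun h => expR (- (a * h)))).
  apply: is_derive_eq; last by rewrite mulr0 oppr0 expR0 /GRing.scale/= mulr1 mul1r.
by rewrite -[X in _ --> X]scale1r; apply: cvgZ xy; exact: cvg_right_expR.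
Qed.

Lemma rescale_gen_at a T x y :
  gen_at (rescale a T) x y -> gen_at T x (y + a *: x).
Proof.
move=> /(@gen_at_rescale (- a)); rewrite scaleNr opprK /gen_at.
suff -> : diff_quot (rescale (- a) (rescale a T)) x = diff_quot T x by [].
by apply/funext => h; rewrite /diff_quot rescaleK.
Qed.

Lemma C0_rescale a T : C0_semigroup T -> C0_semigroup (rescale a T).
Proof.
move=> [Tc T0 TD Tx]; split=> [t t0|x|s t s0 t0 x|x].
- have /continuous_linearP[C C0 CT] := Tc t t0.
  apply/continuous_linearP; exists (expR (- (a * t)) * C) => [|x].
    by rewrite mulr_gt0// expR_gt0.
  by rewrite /rescale /= normrZ ger0_norm ?expR_ge0// -mulrA ler_wpM2l// expR_ge0.
- by rewrite /rescale /= mulr0 oppr0 expR0 scale1r T0.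
- by rewrite /rescale /= TD// [T s (_ *: _)]linearZ /= scalerA -expRD mulrDr opprD.
- by rewrite -[X in _ --> X]scale1r; apply: cvgZ (Tx x); exact: cvg_right_expR.
Qed.

(** The semigroup [S] decays exponentially, so some [S tau] halves norms and the generator A - a of
    [S] is invertible. *)
Lemma growth_resolvent T M w a : C0_semigroup T ->
  (forall t, 0 <= t -> forall x, `|T t x| <= M * expR (w * t) * `|x|) ->
  w < a -> resolvent_set (generator T) a.
Proof.
move=> C0T BM wa; pose S := rescale a T.
have C0S : C0_semigroup S by exact: C0_rescale.
have aw0 : 0 < a - w by rewrite subr_gt0.
(* Then (a - w) tau is 2 (|M| + 1), whose exponential is at least 2 |M|. *)
pose tau := 2 * (`|M| + 1) / (a - w).
have M10 : 0 < `|M| + 1 by rewrite ltr_wpDl.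
have tau0 : 0 < tau by rewrite divr_gt0// mulr_gt0.
have half x : `|S tau x| <= 2^-1 * `|x|.
  rewrite /S /rescale /= normrZ ger0_norm ?expR_ge0//.
  rewrite (@le_trans _ _ (expR (- (a * tau)) * (M * expR (w * tau) * `|x|)))//.
    by rewrite ler_wpM2l ?expR_ge0// BM// ltW.
  rewrite mulrA ler_wpM2r// mulrCA -expRD.
  rewrite (_ : _ + _ = - ((a - w) * tau)); last by ring.
  rewrite /tau mulrCA divff ?gt_eqF// mulr1 expRN.
  rewrite ler_pdivrMr ?expR_gt0// (le_trans (ler_norm M))//.
  rewrite ler_pdivlMl// (le_trans _ (expR_ge1Dx _))//.
  by have := normr_ge0 M; lra.
have [C Cpos Cle] := gen_norm_le C0S tau0 half.
(* The sign is reversed because [G] is to invert a - A, whereas [S] has generator A - a. *)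
have /choice[G GP] v : exists z, gen_at S z (- v) by exact: (gen_surj C0S tau0 half).
have uniq z z' v : gen_at S z v -> gen_at S z' v -> z = z'.
  move=> zv /(@gen_at_linear S (-1) _ _ _ _)/(_ zv).
  rewrite !scaleN1r addNr => /Cle; rewrite normr0 mulr0 normr_le0 addrC subr_eq0.
  by move/eqP.
have linG : linear G.
  move=> k u v; apply: uniq (GP _) _.
  by rewrite opprD -scalerN; exact: gen_at_linear.
pose G' : {linear E -> E} := HB.pack G (GRing.isLinear.Build _ _ _ _ G linG).
have GT v : gen_at T (G v) (- v + a *: G v) by exact: rescale_gen_at.
exists G'; split.
- apply/continuous_linearP; exists C => // x /=.
  by rewrite -(normrN x); exact: Cle (GP x).
- move=> v; have [dv ->] := generatorE (GT v); split => //.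
  by rewrite opprD opprK addrCA subrr addr0.
- move=> v dv; apply: uniq (GP _) _; rewrite opprB.
  exact/gen_at_rescale/generator_gen_at.
Qed.

End rescaling.

(** * Completeness of products *)

Section prod_complete.
Context (R : realType) (E F : completeNormedModType R).

HB.instance Definition _ := isPointed.Build (E * F)%type (0, 0).

(** Both projections of the filter converge. This provides the complete space on which the rotated
    semigroup acts. *)
Lemma prod_complete (G : set_system (E * F)%type) :
  ProperFilter G -> cauchy G -> cvg G.
Proof.
move=> FG /cauchyP Gc.
have c1 : cvg ((fun z : E * F => z.1) @ G).
  apply/cauchy_cvgP/cauchy_exP => e e0; have /= [z Gz] := Gc e e0.
  by exists z.1; apply: filterS Gz => x; rewrite /ball /= /prod_ball => -[].
have c2 : cvg ((fun z : E * F => z.2) @ G).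
  apply/cauchy_cvgP/cauchy_exP => e e0; have /= [z Gz] := Gc e e0.
  by exists z.2; apply: filterS Gz => x; rewrite /ball /= /prod_ball => -[].
apply/cvg_ex; exists (lim ((fun z : E * F => z.1) @ G), lim ((fun z : E * F => z.2) @ G)).
move=> A nA; have : G [set z | A (z.1, z.2)] by exact: cvg_pair c1 c2 _ nA.
by apply: filterS => -[].
Qed.

HB.instance Definition _ := Uniform_isComplete.Build (E * F)%type prod_complete.
End prod_complete.

(** * Rotated semigroups *)

Section complexification.
Context (R : realType) (E : completeNormedModType R) (T : R -> {linear E -> E}).
Hypothesis C0T : C0_semigroup T.

(** For cosines [a], [c] and sines [a'], [c'], both sides are the first component of a product of
    two rotations: by the addition formulas, and in two steps. *)
Lemma scale_rotation (a a' c c' : R) (u v : E) :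
  (a * c - a' * c') *: u + (a' * c + a * c') *: v =
  a *: (c *: u + c' *: v) + a' *: (c *: v - c' *: u).
Proof.
rewrite scalerBl scalerDl !scalerDr !scalerN !scalerA.
by rewrite (addrC (_ *: v)) addrACA (addrC (- _)).
Qed.

Lemma eq_cvg_to (f g : R -> E) (l : E) : f =1 g ->
  f h @[h --> 0^'+] --> l -> g h @[h --> 0^'+] --> l.
Proof. by move=> /funext ->. Qed.

(* exp (- i b t) T(t) on E + iE. *)
Definition rotate_fun (b t : R) (z : E * E) : E * E :=
  (cos (b * t) *: T t z.1 + sin (b * t) *: T t z.2,
   cos (b * t) *: T t z.2 - sin (b * t) *: T t z.1).

Lemma rotate_linear b t : linear (rotate_fun b t).
Proof.
have swap (a k : R) (x x' : E) : a *: (k *: x + x') = k *: (a *: x) + a *: x'.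
  by rewrite scalerDr !scalerA mulrC.
move=> k [x y] [x' y']; rewrite /rotate_fun /=; congr pair => /=.
  by rewrite !(linearP (T t)) ![in LHS]swap addrACA -scalerDr.
by rewrite !(linearP (T t)) ![in LHS]swap opprD addrACA -scalerN -scalerDr.
Qed.

HB.instance Definition _ b t :=
  GRing.isLinear.Build R (E * E)%type (E * E)%type _ (rotate_fun b t) (rotate_linear b t).

Definition rotate b (t : R) : {linear (E * E)%type -> (E * E)%type} := rotate_fun b t.

(** Each component is a sum of two terms, each at most [C] times the maximum norm; hence the factor
    2. *)
Lemma rotate_norm_le b t C : 0 <= C -> (forall x, `|T t x| <= C * `|x|) ->
  forall z, `|rotate b t z| <= 2 * C * `|z|.
Proof.
move=> C0 TC [x y].
have le_sum (c s : R) (u v : E) : `|c| <= 1 -> `|s| <= 1 ->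
    `|c *: T t u + s *: T t v| <= C * (`|u| + `|v|).
  move=> c1 s1; rewrite (le_trans (ler_normD _ _))// mulrDr !normrZ.
  by rewrite lerD// -[leRHS]mul1r ler_pM.
have le_max2 : C * (`|x| + `|y|) <= 2 * C * `|(x, y)|.
  rewrite (mulrC 2) -mulrA ler_wpM2l// prod_normE /=.
  by rewrite mulr_natl mulr2n lerD// le_max lexx ?orbT.
rewrite {1}prod_normE /= ge_max; apply/andP; split.
  by rewrite (le_trans _ le_max2)// le_sum// ?cos_max ?sin_max.
rewrite (le_trans _ le_max2)// addrC -scaleNr [`|x| + _]addrC addrC le_sum ?cos_max//.
by rewrite normrN sin_max.
Qed.

Lemma cvg_right_cos b : cos (b * h) @[h --> 0^'+] --> (1 : R).
Proof.
have := @cvg_right_cont R (fun h => cos (b * h)).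
rewrite mulr0 cos0; apply => z.
by apply: differentiable_continuous; exact/derivable1_diffP.
Qed.

Lemma cvg_right_sin b : sin (b * h) @[h --> 0^'+] --> (0 : R).
Proof.
have := @cvg_right_cont R (fun h => sin (b * h)).
rewrite mulr0 sin0; apply => z.
by apply: differentiable_continuous; exact/derivable1_diffP.
Qed.

Lemma C0_rotate b : C0_semigroup (rotate b).
Proof.
case: (C0T) => Tc T0 TD Tx; split=> [t t0|[x y]|s t s0 t0 [x y]|[x y]].
- have /continuous_linearP[C C0 CT] := Tc t t0.
  apply/continuous_linearP; exists (2 * C); first by rewrite mulr_gt0.
  by apply: rotate_norm_le => //; exact: ltW.
- by rewrite /rotate /= /rotate_fun /= mulr0 cos0 sin0 !scale1r !scale0r subr0 addr0 !T0.
- rewrite /rotate /= /rotate_fun /= !TD// mulrDr cosD sinD.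
  rewrite !(linearD (T s)) !(linearN (T s)) !(linearZ_LR (T s)) /= scale_rotation.
  congr pair.
  have := scale_rotation (cos (b * s)) (sin (b * s)) (cos (b * t)) (sin (b * t))
    (T s (T t y)) (- T s (T t x)).
  by rewrite !scalerN -opprD -scalerN => ->; rewrite scalerN.
- have c1 := @cvg_right_cos b; have s1 := @cvg_right_sin b.
  apply: cvg_pair => /=.
    rewrite -[X in _ --> nbhs X]addr0 -[X in _ --> nbhs (X + _)]scale1r.
    rewrite -[X in _ --> nbhs (_ + X)](scale0r y).
    by apply: cvgD; apply: cvgZ.
  rewrite -[X in _ --> nbhs X]subr0 -[X in _ --> nbhs (X - _)]scale1r.
  rewrite -[X in _ --> nbhs (_ - X)](scale0r x).
  by apply: cvgB; apply: cvgZ.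
Qed.

(** Product rule, with [c] and [s] standing for the cosine and for plus or minus the sine. It serves
    both components of the rotation and of its inverse. *)
Lemma diff_quot_rotate (p q : R -> E) (c s : R -> R) (x y u v : E) (be : R) :
  h^-1 *: (p h - x) @[h --> 0^'+] --> u ->
  h^-1 *: (q h - y) @[h --> 0^'+] --> v ->
  c h @[h --> 0^'+] --> (1 : R) -> s h @[h --> 0^'+] --> (0 : R) ->
  h^-1 * (c h - 1) @[h --> 0^'+] --> (0 : R) -> h^-1 * s h @[h --> 0^'+] --> be ->
  h^-1 *: (c h *: p h + s h *: q h - x) @[h --> 0^'+] --> u + be *: y.
Proof.
move=> pu qv c1 s0 c'0 s'b.
rewrite [X in X @ _](_ : _ = fun h =>
   c h *: (h^-1 *: (p h - x)) + s h *: (h^-1 *: (q h - y))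
   + (h^-1 * (c h - 1)) *: x + (h^-1 * s h) *: y).
  rewrite [X in _ --> X](_ : _ = 1 *: u + 0 *: v + 0 *: x + be *: y); last first.
    by rewrite scale1r !scale0r !addr0.
  apply: cvgD; last exact: cvgZr_tmp.
  by apply: cvgD; [apply: cvgD; apply: cvgZ | apply: cvgZr_tmp].
apply/funext => h; rewrite !scalerA (mulrC (c h)) (mulrC (s h)) -!scalerA -!scalerDr.
congr (_ *: _); rewrite !scalerBr scalerBl scale1r.
rewrite [X in _ = X + _]addrAC -[RHS]addrA subrK.
by rewrite [X in _ = X + _]addrA subrK addrAC.
Qed.

Section gen_rotate.
Variable b : R.

Let cosb1 := cvg_right_cos b.
Let sinb0 := cvg_right_sin b.

Let cos_diff : h^-1 * (cos (b * h) - 1) @[h --> 0^'+] --> (0 : R).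
Proof.
have := @cvg_right_diff R (fun h => cos (b * h)) 0.
rewrite mulr0 cos0; apply.
by apply: is_derive_eq; rewrite mulr0 sin0 oppr0 mul0r.
Qed.

Let sin_diff : h^-1 * sin (b * h) @[h --> 0^'+] --> b.
Proof.
have := @cvg_right_diff R (fun h => sin (b * h)) b.
rewrite mulr0 sin0 (_ : (fun h => _ * (_ - 0)) = (fun h => h^-1 * sin (b * h))).
  apply.
  by apply: is_derive_eq; rewrite mulr0 cos0 mul1r /GRing.scale/= mulr1.
by apply/funext => h; rewrite subr0.
Qed.

(** The formulas express the generator A - ib in real coordinates. From right to left this is the
    product rule; from left to right the rule is applied to the inverse rotation, which recovers
    [T]. *)
Lemma gen_at_rotateP (z y : E * E) : gen_at (rotate b) z y <->
  gen_at T z.1 (y.1 - b *: z.2) /\ gen_at T z.2 (y.2 + b *: z.1).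
Proof.
have sinN0 : - sin (b * h) @[h --> 0^'+] --> (0 : R).
  by have := cvgN sinb0; rewrite oppr0; apply.
have sinN_diff : h^-1 * - sin (b * h) @[h --> 0^'+] --> - b.
  rewrite (_ : (fun h => _) = (fun h => - (h^-1 * sin (b * h)))); first exact: cvgN.
  by apply/funext => h; rewrite mulrN.
case: z y => [x1 x2] [y1 y2] /=; split=> [xy|[g1 g2]].
  have g1 : h^-1 *: ((rotate b h (x1, x2)).1 - x1) @[h --> 0^'+] --> y1.
    exact: (cvg_comp _ _ xy (@cvg_fst _ _ _ _ _)).
  have g2 : h^-1 *: ((rotate b h (x1, x2)).2 - x2) @[h --> 0^'+] --> y2.
    exact: (cvg_comp _ _ xy (@cvg_snd _ _ _ _ _)).
  have e1 h : cos (b * h) *: (rotate b h (x1, x2)).1 +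
      (- sin (b * h)) *: (rotate b h (x1, x2)).2 = T h x1.
    rewrite /= -scale_rotation mulNr opprK -!expr2 cos2Dsin2 scale1r.
    by rewrite mulNr mulrC addNr scale0r addr0.
  have e2 h : cos (b * h) *: (rotate b h (x1, x2)).2 +
      sin (b * h) *: (rotate b h (x1, x2)).1 = T h x2.
    have := scale_rotation (cos (b * h)) (sin (b * h)) (cos (b * h))
      (- sin (b * h)) (T h x2) (T h x1).
    rewrite mulrN opprK -!expr2 cos2Dsin2 scale1r mulrN (mulrC (sin _)) subrr.
    by rewrite scale0r addr0 !scaleNr opprK => Th; rewrite [RHS]Th.
  split; rewrite /gen_at.
    have := diff_quot_rotate g1 g2 cosb1 sinN0 cos_diff sinN_diff.
    rewrite (scaleNr b) => H; apply: (eq_cvg_to _ H) => h.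
    by rewrite e1.
  have := diff_quot_rotate g2 g1 cosb1 sinb0 cos_diff sin_diff.
  by move=> H; apply: (eq_cvg_to _ H) => h; rewrite e2.
have := diff_quot_rotate g1 g2 cosb1 sinb0 cos_diff sin_diff.
have := diff_quot_rotate g2 g1 cosb1 sinN0 cos_diff sinN_diff.
rewrite scaleNr addrK subrK => H2 H1.
rewrite /gen_at (_ : diff_quot _ _ = fun h =>
  (h^-1 *: (cos (b * h) *: T h x1 + sin (b * h) *: T h x2 - x1),
   h^-1 *: (cos (b * h) *: T h x2 + (- sin (b * h)) *: T h x1 - x2))).
  exact: cvg_pair H1 H2.
by apply/funext => h; rewrite /diff_quot scaleNr.
Qed.
End gen_rotate.

End complexification.

(** * The resolvent on the complexification *)

Section complex_resolvent.
Context (R : realType) (E : completeNormedModType R) (T : R -> {linear E -> E}).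
Hypothesis C0T : C0_semigroup T.

Definition cgen_at (z y : cplx E) : Prop := gen_at T z.1 y.1 /\ gen_at T z.2 y.2.

Lemma cgen_at_linear (l : R[i]) (z z' y y' : cplx E) :
  cgen_at z y -> cgen_at z' y' -> cgen_at (l *: z + z') (l *: y + y').
Proof.
move: l z z' y y' => [a b] [x1 x2] [x1' x2'] [y1 y2] [y1' y2'] [/= g1 g2] [/= g1' g2'].
split => /=; rewrite -?scaleNr -!addrA.
  by apply: gen_at_linear => //; exact: gen_at_linear.
by apply: gen_at_linear => //; exact: gen_at_linear.
Qed.

(** For l = a + ib, the operator l - A is a - (A - ib), and A - ib generates the rotated semigroup,
    which grows at the same rate [w]. *)
Lemma cplx_resolvent M w (l : R[i]) :
  (forall t, 0 <= t -> forall x, `|T t x| <= M * expR (w * t) * `|x|) ->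
  w < complex.Re l -> resolvent_set (cplx_op (generator T)) l.
Proof.
move: l => [a b] BM /= wa.
have BW t : 0 <= t -> forall z, `|rotate T b t z| <= 2 * `|M| * expR (w * t) * `|z|.
  move=> t0 z; rewrite -(mulrA 2); apply: rotate_norm_le => [|x].
    by rewrite mulr_ge0 ?expR_ge0.
  by rewrite (le_trans (BM _ t0 _))// !ler_wpM2r ?expR_ge0// ler_norm.
have [G [Gc Gr Gl]] := growth_resolvent (C0_rotate C0T b) BW wa.
pose Q (v z : cplx E) := cgen_at z ((a +i* b)%C *: z - v).
have Q_gen v z : Q v z <-> gen_at (rotate T b) z (a *: z - v : (E * E)%type).
  rewrite gen_at_rotateP /Q /cgen_at /=.
  by rewrite (addrAC (a *: z.1)) (addrC (a *: z.2 - v.2)) addrA.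
have QG v : Q v (G v).
  apply/Q_gen; have [dv vE] := Gr v.
  have := generator_gen_at dv; congr (gen_at _ _ _).
  by apply/eqP; rewrite eq_sym subr_eq addrC -subr_eq vE.
have Q_uniq v z z' : Q v z -> Q v z' -> z = z'.
  have GQ y : Q v y -> G v = y.
    move=> /Q_gen/generatorE[dy yE]; rewrite -[RHS]Gl// yE.
    by rewrite opprB addrCA subrr addr0.
  by move=> /GQ <- /GQ.
(* [G] comes as a real-linear map; uniqueness of solutions makes it complex-linear. *)
have linG : linear (G : cplx E -> cplx E).
  move=> k u v; apply: Q_uniq (QG _) _.
  have := cgen_at_linear k (QG u) (QG v); congr (cgen_at _ _).
  rewrite scalerBr scalerDr opprD addrACA; congr (_ + _ + _).
  by rewrite !scalerA mulrC.
pose G' : {linear cplx E -> cplx E} :=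
  HB.pack (G : cplx E -> cplx E)
    (GRing.isLinear.Build _ _ _ _ (G : cplx E -> cplx E) linG).
exists G'; split.
- exact: Gc.
- move=> v; have [/generatorE[d1 E1] /generatorE[d2 E2]] := QG v.
  split; first by split.
  rewrite [app _ _](_ : _ = (app (generator T) (G v).1, app (generator T) (G v).2)) //.
  by rewrite E1 E2 -surjective_pairing opprB addrCA subrr addr0.
- move=> v [d1 d2]; apply: Q_uniq (QG _) _.
  by split; rewrite /= opprB addrCA subrr addr0; exact: generator_gen_at.
Qed.

Lemma gen_at0 : gen_at T 0 0.
Proof.
rewrite /gen_at (_ : diff_quot T 0 = cst 0); first exact: cvg_cst.
by apply/funext => h; rewrite /diff_quot linear0 subrr scaler0.
Qed.

(** For real [a], the operator a - A acts on real and imaginary parts separately, so the real part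
    of the complex resolvent on real vectors inverts it. *)
Lemma real_resolvent (a : R) :
  resolvent_set (cplx_op (generator T)) (a +i* 0)%C -> resolvent_set (generator T) a.
Proof.
move=> [G [Gc Gr Gl]]; pose G1 (x : E) : E := (G (x, 0)).1.
have linG1 : linear G1.
  move=> k u v; rewrite /G1.
  have -> : ((k *: u + v, 0) : cplx E) = (k +i* 0)%C *: ((u, 0) : cplx E) + (v, 0).
    by congr pair; rewrite /= ?scaler0 ?scale0r ?subr0 ?addr0.
  by rewrite linearP /= scale0r subr0.
pose G1' : {linear E -> E} := HB.pack G1 (GRing.isLinear.Build _ _ _ _ G1 linG1).
have [dom0 app0] := generatorE gen_at0.
exists G1'; split.
- move=> x; rewrite /G1' /= /G1.
  have Gx : {for (x, 0) : cplx E, continuous G} by exact: Gc.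
  have ix : ((y, 0) : cplx E) @[y --> x] --> ((x, 0) : cplx E).
    by apply: cvg_pair => //; exact: cvg_cst.
  have := cvg_comp _ _ ix Gx => H.
  exact: (cvg_comp _ _ H (@cvg_fst _ _ _ _ _)).
- move=> v; have [[d1 _] /(congr1 fst) /= E1] := Gr (v, 0).
  by split; [exact: d1 | move: E1; rewrite scale0r subr0; exact].
- move=> v dv; rewrite /G1' /= /G1.
  rewrite -[RHS](congr1 fst (Gl (v, 0) (conj dv dom0))).
  congr (G _).1; congr pair; first by rewrite /= scaler0 subr0.
  rewrite [X in _ = _ - X](_ : _ = app (generator T) 0) //.
  by rewrite app0 /= scale0r scaler0 addr0 subr0.
Qed.

End complex_resolvent.

(** * Positive resolvents on Banach lattices *)

Section banach_lattice.
Context (R : realType) (E : banachLatticeType R).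
Implicit Types x y z : E.

Lemma lev_add x y x' y' : x <= y -> x' <= y' -> x + x' <= y + y'.
Proof.
move=> xy xy'; apply: (@le_trans _ _ (y + x')); first exact: vle_add2r.
by rewrite ![y + _]addrC; exact: vle_add2r.
Qed.

Lemma subv_ge0 x y : (0 <= y - x) = (x <= y).
Proof.
by apply/idP/idP => /(@vle_add2r R E) h; [have := h x | have := h (- x)];
  rewrite ?subrK ?add0r ?subrr.
Qed.

Lemma addv_ge0 x y : 0 <= x -> 0 <= y -> 0 <= x + y.
Proof. by move=> x0 y0; rewrite -[0]addr0 lev_add. Qed.

Lemma sumv_ge0 (I : finType) (f : I -> E) : (forall i, 0 <= f i) -> 0 <= \sum_i f i.
Proof. by move=> f0; elim/big_ind: _ => //; exact: addv_ge0. Qed.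

Lemma scalev_ge0 (a : R) x : 0 <= a -> 0 <= x -> 0 <= a *: x.
Proof. exact: vscale_ge0. Qed.

Lemma scalev_le2l (a : R) x y : 0 <= a -> x <= y -> a *: x <= a *: y.
Proof. by rewrite -(subv_ge0 x) -(subv_ge0 (a *: x)) -scalerBr; exact: scalev_ge0. Qed.

Lemma vabs_ge0 x : 0 <= vabs x.
Proof.
have h : 0 <= vabs x + vabs x.
  rewrite -(subrr x) /vabs; apply: lev_add; [exact: leUl|exact: leUr].
rewrite -[vabs x]scale1r (_ : 1 = 2^-1 *+ 2); last first.
  by rewrite -(mulr_natr 2^-1) mulVf ?pnatr_eq0.
by rewrite mulr2n scalerDl -scalerDr scalev_ge0// invr_ge0.
Qed.

Lemma ger0_vabs x : 0 <= x -> vabs x = x.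
Proof.
move=> x0; apply: join_l; apply: (le_trans _ x0).
by rewrite -subv_ge0 opprK add0r.
Qed.

Lemma vabs_le_norm x y : vabs x <= vabs y -> `|x| <= `|y|.
Proof. exact: vnorm_le. Qed.

Lemma ge0_norm_le x y : 0 <= x -> x <= y -> `|x| <= `|y|.
Proof.
by move=> x0 xy; apply: vabs_le_norm; rewrite !ger0_vabs// (le_trans x0).
Qed.

(** The negative part [n] of [x] satisfies [n <= vabs (x - y)] for every [y >= 0], so its norm is at
    most every positive [e]. *)
Lemma ge0_closed x : (forall e : R, 0 < e -> exists2 y, 0 <= y & `|x - y| <= e) -> 0 <= x.
Proof.
move=> xP; pose n := Order.join (- x) 0.
have n0 : 0 <= n by exact: leUr.
have nn y : 0 <= y -> `|n| <= `|x - y|.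
  move=> y0; apply: vabs_le_norm; rewrite (ger0_vabs n0) leUx vabs_ge0 andbT.
  apply: (@le_trans _ _ (- (x - y))); last exact: leUr.
  by rewrite -subv_ge0 opprB opprK subrK.
have : n = 0.
  apply/eqP; rewrite -normr_le0; apply/ler_addgt0Pr => e e0.
  by have [y y0 ye] := xP e e0; rewrite add0r (le_trans (nn y y0)).
by move=> nz; rewrite -[x]opprK -[- - x]add0r subv_ge0 -nz; exact: leUl.
Qed.
End banach_lattice.

(** * Positivity of the resolvent *)

Section positive_resolvent.
Context (R : realType) (E : banachLatticeType R) (T : R -> {linear E -> E}).
Hypothesis C0T : C0_semigroup T.

(* [z - S t z] is the integral of [S r w] over [r] in [[0, t]]. *)
Lemma gen_lower_bound (S : R -> {linear E -> E}) (z w y : E) (t : R) :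
  C0_semigroup S -> gen_at S z (- w) -> 0 <= t ->
  (forall r, 0 <= r -> r <= t -> y <= S r w) -> t *: y <= z - S t z.
Proof.
move=> C0S zw t0 Sw; rewrite -subv_ge0; apply: ge0_closed => e e0.
have [N N0 /(_ N (leqnn _))] := riemann_gen C0S zw t0 e0.
set h := t / N%:R => H.
have h0 : 0 <= h by rewrite divr_ge0.
have Nh : N%:R * h = t by rewrite mulrC divfK// pnatr_eq0 -lt0n.
(* The witness is a Riemann sum of [S r w - y], positive term by term. *)
exists (h *: \sum_(k < N) (S (k%:R * h) w - y)).
  apply/scalev_ge0/sumv_ge0 => // k; rewrite subv_ge0 Sw ?mulr_ge0// -Nh ler_wpM2r//.
  by rewrite ler_nat ltnW.
rewrite sumrB sumr_const card_ord -[y *+ N]scaler_nat scalerBr scalerA (mulrC h) Nh.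
rewrite opprB addrA subrK; move: H.
by rewrite -(scaleN1r w) rsumZ scaleN1r scalerN opprK -normrN opprD opprB.
Qed.

(** Positivity of the inverse of a - A, phrased through the solutions of (a - A) z = v so that it
    makes sense for every [a]. *)
Definition positive_at (a : R) : Prop :=
  forall v z : E, 0 <= v -> gen_at T z (a *: z - v) -> 0 <= z.

(** [z - S t z] is positive, and [S t z] tends to 0. *)
Lemma positive_at_large M w a : positive_semigroup T ->
  (forall t, 0 <= t -> forall x, `|T t x| <= M * expR (w * t) * `|x|) -> w < a ->
  positive_at a.
Proof.
move=> posT BM wa v z v0 zv; pose S := rescale a T.
have zS : gen_at S z (- v).
  by have := gen_at_rescale (a := a) zv; rewrite addrAC subrr add0r.
apply: ge0_closed => e e0.
have aw : 0 < a - w by rewrite subr_gt0.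
have M0 : 0 <= `|M| * `|z| / e by rewrite !mulr_ge0// invr_ge0 ltW.
(* Then the exponential of (a - w) t is at least |M| |z| / e, which brings the norm of [S t z] below
   [e]. *)
pose t := `|M| * `|z| / e / (a - w).
have t0 : 0 <= t by rewrite divr_ge0// ltW.
exists (z - S t z).
  rewrite -(scaler0 _ t); apply: gen_lower_bound zS t0 _; first exact: C0_rescale.
  by move=> r r0 _; apply: scalev_ge0; [exact: expR_ge0 | exact: posT].
rewrite opprB addrC subrK /S /rescale /= normrZ ger0_norm ?expR_ge0//.
rewrite (le_trans (ler_wpM2l (expR_ge0 _) (BM t t0 z)))//.
have -> : expR (- (a * t)) * (M * expR (w * t) * `|z|) =
    (expR ((a - w) * t))^-1 * (M * `|z|).
  rewrite -expRN (_ : - ((a - w) * t) = - (a * t) + w * t); last by ring.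
  by rewrite expRD; ring.
rewrite ler_pdivrMl ?expR_gt0//.
rewrite (@le_trans _ _ (`|M| * `|z|))// ?ler_wpM2r ?ler_norm//.
rewrite -ler_pdivrMr// (le_trans _ (expR_ge1Dx _))//.
by rewrite /t mulrCA divff ?gt_eqF// mulr1 lerDr.
Qed.

Definition resolvent_bound (a C : R) : Prop :=
  forall v z : E, gen_at T z (a *: z - v) -> `|z| <= C * `|v|.

Lemma resolventP a : resolvent_set (generator T) a ->
  exists G : {linear E -> E}, (forall v z, gen_at T z (a *: z - v) <-> z = G v) /\
  exists2 C, 0 < C & resolvent_bound a C.
Proof.
move=> [G [/continuous_linearP [C C0 GC] Gr Gl]].
have GP v z : gen_at T z (a *: z - v) <-> z = G v.
  split=> [/generatorE[dz zE]|->].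
    by rewrite -[LHS]Gl// zE opprB addrCA subrr addr0.
  have [dv vE] := Gr v; have := generator_gen_at dv.
  have -> // : app (generator T) (G v) = a *: G v - v.
  by apply/eqP; rewrite eq_sym subr_eq addrC -subr_eq vE.
exists G; split=> //; exists C => // v z /GP ->; exact: GC.
Qed.

Lemma gen_at_shift a b v z :
  gen_at T z (a *: z - v) -> gen_at T z (b *: z - (v + (b - a) *: z)).
Proof.
have -> // : b *: z - (v + (b - a) *: z) = a *: z - v.
by rewrite scalerBl !opprD opprK addrCA (addrA (b *: z)) subrr add0r addrC.
Qed.

(** Seen from [a], the right-hand side is [v + (a - b) *: z], and its term in [z] contributes at
    most half the norm of [z]. *)
Lemma resolvent_bound_near a b C : 0 < C -> resolvent_bound a C ->
  `|a - b| * C <= 2^-1 -> resolvent_bound b (2 * C).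
Proof.
move=> C0 aC ab v z /(@gen_at_shift b a) /aC zC.
have : C * `|(a - b) *: z| <= 2^-1 * `|z|.
  by rewrite normrZ mulrCA mulrA ler_wpM2r.
have : `|z| <= C * `|v| + C * `|(a - b) *: z|.
  by rewrite (le_trans zC)// -mulrDr ler_pM2l// ler_normD.
by rewrite -mulrA; lra.
Qed.

(** [z = G (v + (b - a) *: z)] for the positive resolvent [G] at [b]. Iterating from 0 yields
    positive vectors that converge to [z] with ratio 1/2. *)
Lemma positive_at_left a b C : 0 < C -> resolvent_set (generator T) b ->
  resolvent_bound b C -> a <= b -> (b - a) * C <= 2^-1 ->
  positive_at b -> positive_at a.
Proof.
move=> C0 /resolventP[G [GP _]] bC ab baC posb v z v0 /(@gen_at_shift a b)/GP zE.
have ba0 : 0 <= b - a by rewrite subr_ge0.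
have GC x : `|G x| <= C * `|x| by apply: bC; exact/GP.
have G0 x : 0 <= x -> 0 <= G x by move=> x0; apply: posb x0 _; exact/GP.
have approx n : exists2 y, 0 <= y & `|z - y| <= 2^-1 ^+ n * `|z|.
  elim: n => [|n [y y0 IH]]; first by exists 0; rewrite ?lexx// subr0 mul1r.
  exists (G v + (b - a) *: G y); first by rewrite addv_ge0 ?scalev_ge0 ?G0.
  have -> : z - (G v + (b - a) *: G y) = (b - a) *: G (z - y).
    rewrite {1}zE linearD (linearZ_LR G) linearB scalerBr opprD addrACA subrr.
    by rewrite add0r.
  rewrite normrZ ger0_norm// exprS -mulrA.
  rewrite (@le_trans _ _ ((b - a) * (C * `|z - y|)))// ?ler_wpM2l//.
  by rewrite [leLHS]mulrA; apply: ler_pM => //; rewrite mulr_ge0 ?(ltW C0).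
apply: ge0_closed => e e0.
have [n _ nP] := dyadic_small `|z| e0.
have [y y0 yz] := approx n; exists y => //; rewrite (le_trans yz)//.
have := nP n (leqnn n); rewrite natrX mulrC exprVn; exact.
Qed.

(** Let [m] be the infimum of the points of [[l, +oo[] from which on positivity holds. The resolvent
    bound at [m] allows a step of length [d] to the left of [m], as far as [l] permits, so [m] must
    be [l]. *)
Lemma positive_resolvent l : positive_semigroup T ->
  (forall a, l <= a -> resolvent_set (generator T) a) -> positive_at l.
Proof.
move=> posT lres; have [M [w [_ _ BM]]] := C0_growth C0T.
pose Q := [set a | l <= a /\ forall b, a <= b -> positive_at b].
have Q0 : Q (Num.max w l + 1).
  split=> [|b wb]; first by rewrite ler_wpDr// le_max lexx orbT.
  apply: positive_at_large posT BM _; rewrite (lt_le_trans _ wb)//.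
  by rewrite ltr_pwDr// le_max lexx.
have lbQ : lbound Q l by move=> a [].
have infQ : has_inf Q by split; [exists (Num.max w l + 1) | exists l].
set m := inf Q; have lm : l <= m by apply: lb_le_inf => //; case: infQ.
have [_ [_ [C C0 mC]]] := resolventP (lres m lm).
(* A point [b < m + d] has the bound [2 * C], and going from [b] down to [m - d] needs
   [(d + d) * (2 * C) <= 2^-1]. *)
pose d := (8 * C)^-1; have d0 : 0 < d by rewrite invr_gt0 mulr_gt0.
have dC : d * C = 8^-1 by rewrite /d; field; rewrite gt_eqF.
have [b [lb bP] bm] := inf_adherent d0 infQ.
have mb : m <= b by apply: ge_inf; [case: infQ | split].
have bC : resolvent_bound b (2 * C).
  apply: resolvent_bound_near mC _ => //.
  rewrite distrC ger0_norm ?subr_ge0// (@le_trans _ _ (d * C))//.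
    by rewrite ler_pM2r// lerBlDl ltW.
  by rewrite dC lef_pV2 ?posrE// ler_nat.
have step a : l <= a -> m - d <= a -> positive_at a.
  move=> la mda; have [ba|/ltW ab] := leP b a; first exact: bP.
  apply: (positive_at_left (b := b) (C := 2 * C)) => //;
    [exact: mulr_gt0|exact: lres| |exact: bP].
  rewrite (@le_trans _ _ ((d + d) * (2 * C)))//.
    by rewrite ler_pM2r ?mulr_gt0//; move: bm; rewrite -/m; lra.
  have -> : (d + d) * (2 * C) = 4 * (d * C) by ring.
  by rewrite dC; lra.
have Qmax : Q (Num.max l (m - d)).
  split=> [|a]; first by rewrite le_max lexx.
  by rewrite ge_max => /andP[]; exact: step.
have := ge_inf (proj2 infQ) Qmax; rewrite -/m le_max => /orP[ml|]; last lra.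
by apply: step => //; lra.
Qed.

End positive_resolvent.

(** * Order bounded orbits *)

Section growth_bound_le.
Context (R : realType) (E : banachLatticeType R) (T : R -> {linear E -> E}).
Hypothesis C0T : C0_semigroup T.
Hypothesis posT : positive_semigroup T.
Hypothesis ruT : ru_continuous T.
Variable l : R.
Hypothesis lres : forall a, l <= a -> resolvent_set (generator T) a.

Let S := rescale l T.

Let C0S : C0_semigroup S := C0_rescale l C0T.

Let posS : positive_semigroup S.
Proof. by move=> t t0 x x0; apply: scalev_ge0; [exact: expR_ge0 | exact: posT]. Qed.

Let leS t x y : 0 <= t -> x <= y -> S t x <= S t y.
Proof. by move=> t0 xy; rewrite -subv_ge0 -linearB posS// subv_ge0. Qed.

(** Relatively uniform continuity with tolerance 1 bounds [T r x] by [x + u] near 0; the exponential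
    factor in the witness dominates [expR (- (l * r))] on [[0, d]]. *)
Lemma orbit_order_bounded (x : E) : 0 <= x -> exists d w, [/\ 0 < d, 0 <= w &
  forall r, 0 <= r -> r <= d -> S r x <= w].
Proof.
move=> x0; have [u u0 /(_ 1 ltr01)[d /= d0 dP]] := ruT x.
have Tu r : 0 <= r -> r <= d -> T r x <= x + u.
  rewrite le_eqVlt => /predU1P[<- _|r0 rd].
    by case: C0T => _ -> _ _; rewrite -subv_ge0 addrAC subrr add0r.
  have := dP r r0 rd; rewrite scale1r => /(le_trans (leUl _ _)) H.
  by rewrite -(subrK x (T r x)) addrC lev_add.
have xu0 : 0 <= x + u by exact: addv_ge0.
exists d, (expR (`|l| * d) *: (x + u)); split=> //.
  by rewrite scalev_ge0// expR_ge0.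
move=> r r0 rd; apply: (@le_trans _ _ (expR (- (l * r)) *: (x + u))).
  by apply: scalev_le2l; [exact: expR_ge0 | exact: Tu].
rewrite -subv_ge0 -scalerBl scalev_ge0// subr_ge0 ler_expR -mulNr.
rewrite (@le_trans _ _ (`|l| * r))// ?ler_wpM2l//.
by rewrite ler_wpM2r// -normrN ler_norm.
Qed.

(* If [S r x <= w] on [[0, d]] and [z] is the resolvent at [w], then
   [d *: S (d + s) x <= S s z <= z] by the lower bound for [z - S d z]. *)
Lemma orbit_bounded_ge0 (x : E) : 0 <= x ->
  exists K, forall t, 0 <= t -> `|S t x| <= K.
Proof.
move=> x0; have [d [w [d0 w0 dw]]] := orbit_order_bounded x0.
have [_ _ SD _] := C0S.
have [G [GP _]] := resolventP (lres (lexx l)).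
have Gw : gen_at T (G w) (l *: G w - w) by exact/GP.
have z0 : 0 <= G w.
  exact: (positive_resolvent C0T posT lres) w0 Gw.
have zS : gen_at S (G w) (- w).
  by have := gen_at_rescale (a := l) Gw; rewrite addrAC subrr add0r.
set z := G w in z0 zS.
have Sz s : 0 <= s -> S s z <= z.
  move=> s0; rewrite -subv_ge0 -(scaler0 _ s).
  by apply: gen_lower_bound C0S zS s0 _ => r r0 _; exact: posS.
have dz : d *: S d x <= z.
  apply: (@le_trans _ _ (z - S d z)).
    (* [S d x] is [S r (S (d - r) x)], hence below [S r w]. *)
    apply: gen_lower_bound C0S zS (ltW d0) _ => r r0 rd.
    rewrite -{1}(subrK r d) addrC SD ?subr_ge0// leS// dw ?subr_ge0//.
    by rewrite gerBl.
  by rewrite -subv_ge0 opprB addrC subrK posS// ltW.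
(* The first term serves the times up to [d], the second the later ones. *)
exists (`|w| + d^-1 * `|z|) => t t0; have [td|dt] := leP t d.
  rewrite (@le_trans _ _ `|w|)// ?lerDl ?mulr_ge0// ?invr_ge0 ?(ltW d0)//.
  by apply: ge0_norm_le; [exact: posS | exact: dw].
rewrite (@le_trans _ _ (d^-1 * `|z|))// ?lerDr//.
rewrite ler_pdivlMl// -[X in X * _](gtr0_norm d0) -normrZ.
have td0 : 0 <= t - d by rewrite subr_ge0 ltW.
apply: ge0_norm_le; first by apply: scalev_ge0; [exact: ltW | exact: posS].
apply: (le_trans _ (Sz _ td0)).
have -> : d *: S t x = S (t - d) (d *: S d x).
  by rewrite [RHS]linearZ_LR -SD ?(ltW d0)// subrK.
exact: leS.
Qed.

Lemma orbit_bounded (x : E) : exists K, forall t, 0 <= t -> `|S t x| <= K.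
Proof.
(* [x] is the difference of the positive vectors [p] and [p - x]. *)
pose p := Order.join x 0.
have [K1 K1P] : exists K, forall t, 0 <= t -> `|S t p| <= K.
  by apply: orbit_bounded_ge0; exact: leUr.
have [K2 K2P] : exists K, forall t, 0 <= t -> `|S t (p - x)| <= K.
  by apply: orbit_bounded_ge0; rewrite subv_ge0; exact: leUl.
exists (K1 + K2) => t t0; rewrite -[x](subKr p) linearB.
by rewrite (le_trans (ler_normB _ _))// lerD// ?K1P ?K2P.
Qed.

Lemma growth_bound_le : (growth_bound T <= l%:E)%E.
Proof.
have [M M0 MP] := @uniform_boundedness R E E R [set t | 0 <= t] S
  (fun t t0 => let: And4 Sc _ _ _ := C0S in Sc t t0) orbit_bounded.
apply: ereal_inf_lbound; exists l => //; exists (Num.max M 1).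
  by rewrite le_max lexx orbT.
move=> t t0; have e0 := expR_gt0 (l * t); rewrite opnorm_le.
  move=> x; rewrite -(rescaleK l T x t) /rescale /= mulNr opprK.
  rewrite normrZ gtr0_norm// (mulrC _ (expR _)) -mulrA ler_pM2l//.
  by rewrite (le_trans (MP t t0 x))// ler_wpM2r// le_max lexx.
by rewrite mulr_ge0 ?expR_ge0// le_max ler01 orbT.
Qed.

End growth_bound_le.

(** * Comparison of the two bounds *)

Theorem theorem3p1 (R : realType) (E : banachLatticeType R)
    (T : R -> {linear E -> E}) :
  C0_semigroup T -> positive_semigroup T -> ru_continuous T ->
  spectral_bound (generator T) = growth_bound T.
Proof.
move=> C0T posT ruT; apply/eqP; rewrite eq_le; apply/andP; split.
  (* A spectral value with real part above an admissible exponent [w] would lie in the resolvent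
     set. *)
  apply: ge_ereal_sup => _ [a aspec <-]; apply: le_ereal_inf_tmp => _ [w [M M1 MP] <-].
  rewrite lee_fin leNgt; apply/negP => wa; apply: aspec.
  apply: (cplx_resolvent C0T _ wa) => t t0.
  have c0 : 0 <= M * expR (w * t) by rewrite mulr_ge0 ?expR_ge0// (le_trans ler01).
  by apply/(opnorm_le _ c0); exact: MP.
(* Every real [a >= l] exceeds the spectral bound and so belongs to the complex, hence to the real
   resolvent set. *)
have sg l : (spectral_bound (generator T) < l%:E)%E -> (growth_bound T <= l%:E)%E.
  move=> sl; apply: growth_bound_le => // a la; apply: real_resolvent.
  apply: contrapT => aspec; move: sl; rewrite ltNge => /negP; apply.
  apply: (@le_trans _ _ a%:E); first by rewrite lee_fin.
  by apply: ereal_sup_ubound; exists (a +i* 0)%C.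
(* It remains to let [l] decrease to the spectral bound; if that is -oo, the growth bound lies below
   every real number. *)
move: sg; case: (spectral_bound _) => [s| |] sg.
- by apply/lee_addgt0Pr => e e0; apply: sg; rewrite lte_fin ltrDl.
- by rewrite leey.
- case: (growth_bound T) sg => [g| |] sg //.
    by have := sg (g - 1) (ltNyr _); rewrite lee_fin leNgt ltrBlDr ltrDl ltr01.
  by have := sg 0 (ltNyr _); rewrite leye_eq.
Qed.
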